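(* Let $n\ge 2$, $r>0$, and let $h$ be harmonic (i.e. $h\in C^2$ and $\Delta h=\sum_{i=1}^n \partial^2 h/\partial x_i^2=0$) in a domain of $\mathbb{R}^n$ containing the closed hypercube $I_n=I_n(r)=\{\bm{x}\in\mathbb{R}^n : |x_i|\le r,\ i=1,\dots,n\}$. Then: (i) (Surface mean-value formula) $$\frac{1}{\lambda_{n-1}(P_n)}\int_{P_n} h\,d\lambda_{n-1}=\frac{1}{\lambda_{n-1}(D_n)}\int_{D_n} h\,d\lambda_{n-1};$$ (ii) (Volume mean-value formula) for every integer $k\ge 0$, $$\frac{1}{\lambda^{\omega_k}_{n}(I_n)}\int_{I_n} h\,d\lambda^{\omega_k}_{n}=\frac{1}{\lambda^{\omega_{k+1}}_{n-1}(D_n)}\int_{D_n} h\,d\lambda^{\omega_{k+1}}_{n-1}.$$ In particular both the surface and volume mean values of $h$ are attained on $D_n$.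
   Context: $P_n=\partial I_n$ is the boundary of the hypercube, and $\lambda_{n-1}$ on $P_n$ is the $(n-1)$-dimensional surface (Lebesgue) measure on its faces. For $1\le i<j\le n$, $D^{ij}_n=\{\bm{x}\in I_n : |x_k|\le |x_i|=|x_j| \text{ for all } k\ne i,j\}$, and $D_n=\bigcup_{1\le i<j\le n}D^{ij}_n$. On $D_n$, $\lambda_{n-1}$ denotes the $(n-1)$-dimensional measure obtained on each piece $D^{ij}_n$ by parametrizing it by the coordinates other than $x_i$ and taking Lebesgue measure in those coordinates (equivalently, $1/\sqrt2$ times the $(n-1)$-dimensional surface measure); with this normalization $\lambda^{\omega_k}_{n-1}(D_n)=2^{n-1}n!\,r^{n+k-1}/(n+k-1)!$. For $k\ge 0$, $\omega_k(\bm{x})=\frac{(r-\max\{|x_1|,\dots,|x_n|\})^k}{k!}$, and $d\lambda^{\omega_k}_m=\omega_k\,d\lambda_m$, where $\lambda_n$ is Lebesgue measure on $\mathbb{R}^n$. One has $\lambda^{\omega_k}_n(I_n)=2^n n!\,r^{n+k}/(n+k)!$. *)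

(* Defs.v *)
From HB Require Import structures.
From mathcomp Require Import all_boot all_order all_algebra.
From mathcomp Require Import all_classical all_reals all_analysis.
Set Implicit Arguments. Unset Strict Implicit. Unset Printing Implicit Defensive.
Import Order.TTheory GRing.Theory Num.Theory numFieldNormedType.Exports.
Local Open Scope classical_set_scope.
Local Open Scope ring_scope.

Section Defs.
Variables (R : realType) (n : nat).
Notation V := 'rV[R]_n.

Definition ebasis (i : 'I_n) : V := delta_mx 0 i.

Definition C2_on (U : set V) (h : V -> R) : Prop :=
  forall x, U x ->
    {for x, continuous h} /\
    (forall i, derivable h x (ebasis i) /\
               {for x, continuous ('D_(ebasis i) h)}) /\
    (forall i j, derivable ('D_(ebasis i) h) x (ebasis j) /\
                 {for x, continuous ('D_(ebasis j) ('D_(ebasis i) h))}).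

Definition laplacian (h : V -> R) (x : V) : R :=
  \sum_(i < n) 'D_(ebasis i) ('D_(ebasis i) h) x.

Definition cube (r : R) : set V := [set x | forall i, `|x ord0 i| <= r].

Definition harmonic_near_cube (r : R) (h : V -> R) : Prop :=
  exists U : set V, [/\ open U, connected U, cube r `<=` U,
                        C2_on U h & forall x, U x -> laplacian h x = 0].

Definition setc (x : V) (k : 'I_n) (t : R) : V :=
  \row_l (if l == k then t else x ord0 l).

Fixpoint iint (ks : seq 'I_n) (a b : R) (F : V -> R) (x : V) : R :=
  match ks with
  | [::] => F x
  | k :: ks' => Rintegral (@lebesgue_measure R) `[a, b]
                  (fun t => iint ks' a b F (setc x k t))
  end.

Definition others (i : 'I_n) : seq 'I_n := [seq k <- enum 'I_n | k != i].
Definition others2 (i j : 'I_n) : seq 'I_n :=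
  [seq k <- enum 'I_n | (k != i) && (k != j)].

(* integral over the boundary P_n of I_n(r) w.r.t. (n-1)-dim surface measure:
   sum over the 2n faces {x_i = s r}, s = +-1 (overlaps are null) *)
Definition int_P (r : R) (F : V -> R) : R :=
  \sum_(i < n) \sum_(s <- [:: 1; -1]) iint (others i) (- r) r F (const_mx (s * r)).

(* integral over D_n = U_{i<j} D^{ij}_n w.r.t. the normalized measure lambda_{n-1}:
   D^{ij}_n is parametrized by the coordinates other than x_i:
   x_j = t in [-r, r], x_i = s t (s = +-1), x_k in [-|t|, |t|] for k <> i, j. *)
Definition int_D (r : R) (F : V -> R) : R :=
  \sum_(i < n) \sum_(j < n | (i < j)%N) \sum_(s <- [:: 1; -1])
    Rintegral (@lebesgue_measure R) `[- r, r]
      (fun t => iint (others2 i j) (- `|t|) `|t| F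
                  (setc (setc 0 j t) i (s * t))).

Definition int_I (r : R) (F : V -> R) : R := iint (enum 'I_n) (- r) r F 0.

Definition maxabs (x : V) : R := \big[Num.max/0]_(i < n) `|x ord0 i|.
Definition omega (r : R) (k : nat) (x : V) : R := (r - maxabs x) ^+ k / k`!%:R.

End Defs.

(* Main.v *)
(** Let S(t) be the integral of h over the surface of the cube I_t and E(t) the
    integral of h over its (n-2)-dimensional edges, i.e. over the points with
    |x_i| = |x_j| = t for some i < j.  Leibniz' rule writes S'(t) as the flux of
    grad h through the surface, which vanishes by harmonicity, plus twice E(t),
    since every edge bounds two faces.  Hence S = 2 \int_0^t E, and the integral
    of E is the integral of h over D_n, which gives (i).  As
    int_I (h omega_k) = \int_0^r S(t) (r - t)^k / k! dt, exchanging the order of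
    integration with S = 2 \int_0^t E gives (ii).  For h = 1 the same identities
    hold, so the factors 2 cancel in the quotients. *)
Require Import Defs.
From HB Require Import structures.
From mathcomp Require Import all_boot all_order all_algebra.
From mathcomp Require Import ring lra.
From mathcomp Require Import all_classical all_reals all_analysis measurable_realfun.
Import Order.TTheory GRing.Theory Num.Theory numFieldNormedType.Exports.
Local Open Scope ring_scope.
Set Implicit Arguments. Unset Strict Implicit. Unset Printing Implicit Defensive.
Local Open Scope classical_set_scope.

(** The function [h] is controlled only on the cube, while integrability and Fubini are easiest for
    functions that are continuous everywhere. Harmonicity therefore enters as three layers of
    globally continuous functions: [H], [g i] and [q i] stand for [h] and its first and second pure
    derivatives, each composed with [clamp r]. Clamping may destroy differentiability across the
    faces, so the layers are linked by integrals along one coordinate within [-r, r], and the [q i]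
    sum to zero everywhere because [clamp r] lands in the cube. The constant 1 fits the same scheme
    with [g] and [q] zero, so the denominators come out without computing any volume. The
    normalization on D_n is exactly the one that makes its integral the integral of E: as t grows,
    both large coordinates of an edge point move at unit speed, and t is up to sign one of them. The
    weights pass through because [omega] depends on the max norm alone, hence is constant on each
    surface and each edge. *)

Lemma continuous_pair (X Y Z : topologicalType) (p : X -> Y) (q : X -> Z) :
  continuous p -> continuous q -> continuous (fun x => (p x, q x)).
Proof. by move=> cp cq x; exact: (cvg_pair (cp x) (cq x)). Qed.

Lemma continuous_comp2 (X Y Z W : topologicalType) (g : Y * Z -> W)
    (p : X -> Y) (q : X -> Z) :
  continuous g -> continuous p -> continuous q ->
  continuous (fun x => g (p x, q x)).
Proof.
move=> cg cp cq x; apply: (@continuous_comp _ _ _ (fun x => (p x, q x)) g).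
  exact: continuous_pair.
exact: cg.
Qed.

Section ContinuousOperations.
Context {R : realType} {X : topologicalType}.

Lemma continuous_mull (c : R) (f : X -> R) :
  continuous f -> continuous (fun p => c * f p).
Proof. by move=> cf p; apply: cvgM; [exact: cvg_cst|exact: cf]. Qed.

Lemma continuous_mulr (f g : X -> R) :
  continuous f -> continuous g -> continuous (fun p => f p * g p).
Proof. by move=> cf cg p; apply: cvgM; [exact: cf|exact: cg]. Qed.

Lemma continuous_scaler (W : normedModType R) (c : X -> R) (v : W) :
  continuous c -> continuous (fun p => c p *: v).
Proof. by move=> cc p; apply: cvgZ; [exact: cc|exact: cvg_cst]. Qed.

Lemma continuous_sum (I : Type) (s : seq I)
    (W : normedModType R) (f : I -> X -> W) :
  (forall e, continuous (f e)) -> continuous (fun p => \sum_(e <- s) f e p).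
Proof.
move=> cf; elim: s => [|e s IH].
  by under eq_fun do rewrite big_nil; move=> p; exact: cvg_cst.
by under eq_fun do rewrite big_cons; move=> p; apply: cvgD; [exact: cf|exact: IH].
Qed.

End ContinuousOperations.

(** * Integrals of continuous functions *)

Section Integrals.
Context {R : realType}.
Notation mu := (@lebesgue_measure R).
Notation mR := (measurableTypeR R).

(** Rectangles with rational end points form a countable base of the plane, so [O] is a countable
    union of measurable rectangles; those that leave [O] are replaced by the empty set. *)
Lemma open_measurable2 (O : set (R * R)) :
  open O -> measurable (O : set (mR * mR)).
Proof.
move=> oO.
pose B a b c d : set (mR * mR) := `]ratr a, ratr b[ `*` `]ratr c, ratr d[.
rewrite (_ : O = \bigcup_(a : rat) \bigcup_(b : rat) \bigcup_(c : rat)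
   \bigcup_(d : rat) (if `[< B a b c d `<=` O >] then B a b c d else set0)).
  do 4 (apply: bigcupT_measurable_rat => ?).
  by case: ifPn => // _; apply: measurableX; exact: measurable_itv.
apply/seteqP; split; last first.
  by move=> p [a _ [b _ [c _ [d _]]]]; case: asboolP => // + Bp; exact.
move=> [x y] Oxy; have /= := open_nbhs_nbhs (conj oO Oxy).
move=> [[P Q]/= [/nbhs_ballP[e/= e0 eP] /nbhs_ballP[f/= f0 fQ]] PQO].
have [a /[!in_itv]/= /andP[a1 a2]] : exists a, ratr a \in `]x - e, x[%R.
  by apply: rat_in_itvoo; lra.
have [b /[!in_itv]/= /andP[b1 b2]] : exists a, ratr a \in `]x, x + e[%R.
  by apply: rat_in_itvoo; lra.
have [c /[!in_itv]/= /andP[c1 c2]] : exists a, ratr a \in `]y - f, y[%R.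
  by apply: rat_in_itvoo; lra.
have [d /[!in_itv]/= /andP[d1 d2]] : exists a, ratr a \in `]y, y + f[%R.
  by apply: rat_in_itvoo; lra.
exists a => //; exists b => //; exists c => //; exists d => //.
rewrite asboolT; first by split => /=; rewrite in_itv/=; apply/andP.
move=> [u v] [/= /[!in_itv]/= /andP[u1 u2] /andP[v1 v2]].
apply: PQO; split; [apply: eP|apply: fQ] => /=; rewrite /ball/= ltr_norml; lra.
Qed.

Lemma continuous_measurable2 (f : R * R -> R) :
  continuous f -> measurable_fun [set: mR * mR] f.
Proof.
move=> /continuousP cf; apply: (measurability _ (measurable_realfun.RGenOpens.measurableE R)).
by move=> _ [_ [a [b ->] <-]]; rewrite setTI; apply: open_measurable2;
  apply: cf; exact: interval_open.
Qed.

Lemma continuous_integrable_itv (f : R -> R) a b :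
  continuous f -> mu.-integrable `[a, b] (EFin \o f).
Proof.
move=> cf; apply: continuous_compact_integrable; first exact: segment_compact.
exact: continuous_subspaceT.
Qed.

Lemma closed_measurable2 (A : set (R * R)) :
  closed A -> measurable (A : set (mR * mR)).
Proof.
by move=> cA; rewrite -[A]setCK; apply: measurableC; apply: open_measurable2;
  exact: closed_openC.
Qed.

(** Extended by zero off [A], the function is measurable, bounded and supported in a square, hence
    integrable on the plane. The two descriptions of [A] by its sections turn both sides into
    iterated integrals of this one extension; rectangle, cone and triangle are the instances used
    below. *)
Lemma Fubini_closed (f : R * R -> R) (A : set (R * R)) (D1 D2 : set R)
    (E1 E2 : R -> set R) (M : R) :
  continuous f -> closed A -> A `<=` `[- M, M] `*` `[- M, M] ->
  (forall x y, A (x, y) <-> D1 x /\ E1 x y) ->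
  (forall x y, A (x, y) <-> D2 y /\ E2 y x) ->
  \int[mu]_(x in D1) (\int[mu]_(y in E1 x) f (x, y)) =
  \int[mu]_(y in D2) (\int[mu]_(x in E2 y) f (x, y)).
Proof.
move=> cf clA AM A1 A2.
pose g : mR * mR -> R := f \_ A.
have mA := closed_measurable2 clA.
have mg : measurable_fun setT g.
  apply/(measurable_restrictT f mA); apply: measurable_funTS; exact: continuous_measurable2.
have cptB : compact (`[- M, M] `*` `[- M, M] : set (R * R)).
  by apply: compact_setX; exact: segment_compact.
have [C C0 gC] : exists2 C, 0 <= C & forall p, `|g p| <= C * \1_(`[- M, M] `*` `[- M, M]) p.
  have /compact_bounded[C [_ fC]] : compact (f @` (`[- M, M] `*` `[- M, M])).
    by apply: continuous_compact => //; exact: continuous_subspaceT.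
  exists (`|C| + 1) => [|p]; first by rewrite addr_ge0.
  rewrite /g patchE; case: ifPn => [/set_mem/AM pB|_]; last first.
    by rewrite normr0 mulr_ge0 ?addr_ge0.
  rewrite indicE mem_set// mulr1; apply: (fC (`|C| + 1)); last by exists p.
  by rewrite (le_lt_trans (ler_norm _))// ltrDl.
have fin_itv : (mu `[(- M)%R, M] < +oo)%E.
  by rewrite lebesgue_measure_itv/=; case: ifP => // _; rewrite -EFinB ltry.
have intx x : mu.-integrable setT (fun y => (g (x, y))%:E).
  apply: (@le_integrable _ _ _ mu _ measurableT _ (fun y => (C * \1_`[- M, M] y)%:E)).
  - apply/measurable_EFinP; apply: measurableT_comp => //.
  - move=> y _ /=; rewrite lee_fin (le_trans (gC _))//.
    rewrite [leRHS]ger0_norm ?mulr_ge0// ler_wpM2l// !indicE in_setX/=.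
    by case: (x \in _); rewrite /= ?ler0n.
  - under eq_fun do rewrite EFinM; apply: integrableZl => //.
    exact: integrable_indic_itv.
have inty y : mu.-integrable setT (fun x => (g (x, y))%:E).
  apply: (@le_integrable _ _ _ mu _ measurableT _ (fun y => (C * \1_`[- M, M] y)%:E)).
  - apply/measurable_EFinP; apply: measurableT_comp => //.
  - move=> x _ /=; rewrite lee_fin (le_trans (gC _))//.
    rewrite [leRHS]ger0_norm ?mulr_ge0// ler_wpM2l// !indicE in_setX/=.
    by case: (y \in _); rewrite /= ?andbF ?andbT ?ler0n.
  - under eq_fun do rewrite EFinM; apply: integrableZl => //.
    exact: integrable_indic_itv.
have intg : (mu \x mu)%E.-integrable setT (EFin \o g).
  apply: (@le_integrable _ _ _ (mu \x mu)%E _ measurableT _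
     (fun p => (C * \1_(`[- M, M] `*` `[- M, M]) p)%:E)).
  - exact/measurable_EFinP.
  - move=> p _ /=; rewrite lee_fin (le_trans (gC _))//.
    by rewrite [leRHS]ger0_norm ?mulr_ge0.
  - under eq_fun do rewrite EFinM; apply: integrableZl => //.
    have mB : measurable (`[- M, M] `*` `[- M, M] : set (mR * mR)).
      exact: measurableX.
    apply/integrableP; split; first exact/measurable_EFinP.
    under eq_integral do rewrite gee0_abs ?lee_fin//.
    rewrite integral_indic// setIT.
    rewrite [ltLHS](_ : _ = (mu `[(- M)%R, M] * mu `[(- M)%R, M])%E); last first.
      exact: product_measure1E.
    by rewrite lte_mul_pinfty// ge0_fin_numE.
(* The inner real integrals are [fine] of extended ones, so the integrability of every section is
   what lets [fine] be removed. Outside [D1] the section of [A] is empty and contributes 0. *)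
transitivity (fine (\int[mu]_x \int[mu]_y (g (x, y))%:E)%E).
  rewrite Rintegral_mkcond; congr fine; apply: eq_integral => x _.
  rewrite -[RHS]fineK; last exact: integrable_fin_num.
  congr EFin; rewrite patchE; case: ifPn => [/set_mem|/negP] xD.
    rewrite Rintegral_mkcond; congr fine; apply: eq_integral => y _.
    rewrite /g !patchE; congr (if _ then _ else _)%:E.
    by apply/idP/idP => /set_mem h; apply/mem_set; [apply/A1|have /A1[] := h].
  rewrite (eq_integral (cst 0%E)) ?integral0 //= => y _.
  rewrite /g patchE ifF//; apply/negP => /set_mem/A1[Dx _]; apply: xD.
  exact/mem_set.
rewrite (Fubini intg); symmetry.
rewrite Rintegral_mkcond; congr fine; apply: eq_integral => y _.
rewrite -[RHS]fineK; last exact: (integrable_fin_num measurableT (inty y)).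
congr EFin; rewrite patchE; case: ifPn => [/set_mem|/negP] yD.
  rewrite Rintegral_mkcond; congr fine; apply: eq_integral => x _.
  rewrite /g !patchE; congr (if _ then _ else _)%:E.
  by apply/idP/idP => /set_mem h; apply/mem_set; [apply/A2|have /A2[] := h].
rewrite (eq_integral (cst 0%E)) ?integral0 //= => x _.
rewrite /g patchE ifF//; apply/negP => /set_mem/A2[Dx _]; apply: yD.
exact/mem_set.
Qed.

End Integrals.

(** * Integrals with moving end points, and exchanges of the order of integration *)

Section Toolkit.
Context {R : realType}.
Notation mu := (@lebesgue_measure R).
Implicit Types (f g : R -> R) (a b c r t T : R).

Lemma Rintegral_split f a b c : continuous f -> a <= c -> c <= b ->
  \int[mu]_(u in `[a, b]) f u =
  \int[mu]_(u in `[a, c]) f u + \int[mu]_(u in `[c, b]) f u.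
Proof.
move=> cf ac cb; have /= := @Rintegral_itvB R f (BLeft a) (BRight b) c.
rewrite !bnd_simp => /(_ (continuous_integrable_itv a b cf) ac cb).
rewrite (@Rintegral_itv_obnd_cbnd R c (BRight b)) => [<-|]; first by rewrite addrC subrK.
by apply: integrableS (continuous_integrable_itv c b cf) => //;
  apply: subset_itv; rewrite bnd_simp.
Qed.

Lemma Rintegral_opp f a b : continuous f -> a <= b ->
  \int[mu]_(u in `[- b, - a]) f u = \int[mu]_(u in `[a, b]) f (- u).
Proof.
move=> cf ab; rewrite /Rintegral integration_by_substitution_oppr//.
exact: continuous_subspaceT.
Qed.

Lemma Rintegral_sym f t : continuous f -> 0 <= t ->
  \int[mu]_(u in `[- t, t]) f u = \int[mu]_(u in `[0, t]) (f u + f (- u)).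
Proof.
move=> cf t0.
have cfN : continuous (fun u => f (- u)).
  by move=> u; apply: continuous_comp; [exact: opp_continuous|exact: cf].
rewrite (Rintegral_split (c := 0))// ?oppr_le0// addrC RintegralD//;
  [|exact: continuous_integrable_itv..].
by congr (_ + _); rewrite -{1}oppr0 Rintegral_opp.
Qed.

(** Moves the variable end points into the integrand, which reduces continuity in [t] to the case of
    a fixed interval. The maximum with 0 covers negative [t], where the interval is empty. *)
Lemma Rintegral_scale f t : continuous f ->
  \int[mu]_(u in `[- t, t]) f u =
  Num.max 0 t * \int[mu]_(v in `[- 1, 1]) f (Num.max 0 t * v).
Proof.
move=> cf; case: (ltgtP 0 t) => [t0|t0|<-]; last first.
- by rewrite mul0r oppr0 set_itv1 Rintegral_set1.
- by rewrite mul0r set_itv_ge ?Rintegral_set0// bnd_simp -ltNge; lra.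
have ct (k : R) : continuous (fun v : R => k * v) by move=> v; exact: mulrl_continuous.
have cft : continuous (fun v => f (t * v)).
  by move=> u; apply: continuous_comp; [exact: ct|exact: cf].
rewrite -RintegralZl//; last exact: continuous_integrable_itv.
have dt (x : R) : is_derive x 1 (fun v : R => t * v) t.
  by apply: is_derive_eq; rewrite /GRing.scale/= mulr1.
have dtE : (fun v : R => t * v)^`() = cst t.
  by apply/funext => x; rewrite derive1E; have dtx := dt x; exact: derive_val.
have -> : `[- t, t]%classic = `[t * -1, t * 1] by rewrite mulrN mulr1.
rewrite /Rintegral (@integration_by_substitution_increasing _ (fun v => t * v))//.
- by congr fine; apply: eq_integral => x _; rewrite dtE/= mulrC.
- by move=> x y _ _ xy; rewrite ltr_pM2l.
- by move=> x _; rewrite dtE; exact: cst_continuous.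
- by rewrite dtE; exact: is_cvg_cst.
- by rewrite dtE; exact: is_cvg_cst.
- split; first by move=> x _; have := dt x.
  + by apply/cvg_at_right_filter; exact: ct.
  + by apply/cvg_at_left_filter; exact: ct.
- exact: continuous_subspaceT.
Qed.

Lemma le_normr_Rintegral_cst f a b (C : R) : continuous f -> a <= b ->
  (forall u, a <= u <= b -> `|f u| <= C) ->
  `|\int[mu]_(u in `[a, b]) f u| <= C * (b - a).
Proof.
move=> cf ab fC; apply: le_trans (le_normr_Rintegral _ _) _ => //.
  exact: continuous_integrable_itv.
apply: (le_trans (@le_Rintegral _ _ _ mu `[a, b] _ (cst C) _ _ _ _)) => //.
- apply: continuous_integrable_itv => u; apply: cvg_norm; exact: cf.
- by apply: continuous_integrable_itv => u; exact: cvg_cst.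
- rewrite Rintegral_cst//= lebesgue_measure_itv/= lte_fin.
  by move: ab; rewrite le_eqVlt => /predU1P[<-|->//]; rewrite ltxx subrr.
Qed.

Lemma continuous_Rintegral_param (X : topologicalType) (f : X * R -> R) a b :
  continuous f -> a < b ->
  continuous (fun x => \int[mu]_(u in `[a, b]) f (x, u)).
Proof.
move=> cf ab x0.
have cfx x : continuous (fun u => f (x, u)).
  by apply: continuous_comp2 => // u; [exact: cvg_cst|exact: cvg_id].
apply/cvgrPdist_le => e e0.
pose d := e / (b - a).
have d0 : 0 < d by rewrite divr_gt0 ?subr_gt0.
(* Compactness of the segment makes closeness of [f (x, u)] to [f (x0, u)] uniform in [u]; locally,
   both values are compared with [f] at [x0] and a fixed nearby point, at the cost of [d / 2]
   each. *)
have K := iffLR (compact_near_coveringP `[a, b]) (@segment_compact _ a b).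
have : \forall x \near x0, forall u, `[a, b] u -> `|f (x0, u) - f (x, u)| <= d.
  apply: (K X (nbhs x0) (fun x u => `|f (x0, u) - f (x, u)| <= d)) => u _.
  have d2 : 0 < d / 2 by rewrite divr_gt0.
  have /cvgrPdist_le/(_ _ d2) H := cf (x0, u).
  have /cvgrPdist_le/(_ _ d2) H' := cfx x0 u.
  case: H => -[P Q] /= [Px Qu] PQ.
  exists (Q `&` [set v | `|f (x0, u) - f (x0, v)| <= d / 2], P); first by split=> //=; exact: filterI.
  move=> [v x] /= [[Qv vd] Px'].
  have /= h := PQ (x, v) (conj Px' Qv).
  rewrite -(subrKA (f (x0, u))) (le_trans (ler_normD _ _))// [leRHS](splitr d) lerD//.
  by rewrite distrC.
apply: filterS => x fx.
rewrite -RintegralB//; [|exact: continuous_integrable_itv..].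
apply: le_trans (le_normr_Rintegral_cst _ (ltW ab) (C := d) _) _.
- by move=> u; apply: cvgB; exact: cfx.
- by move=> u uab; apply: fx; rewrite /= in_itv.
- by rewrite /d divfK// subr_eq0 gt_eqF.
Qed.

Lemma continuous_Rintegral_sym (X : topologicalType) (f : X * R -> R) (t : X -> R) :
  continuous f -> continuous t ->
  continuous (fun x => \int[mu]_(u in `[- t x, t x]) f (x, u)).
Proof.
move=> cf ct.
have cfx x : continuous (fun u => f (x, u)).
  by apply: continuous_comp2 => // u; [exact: cvg_cst|exact: cvg_id].
under eq_fun do rewrite Rintegral_scale//.
have cm : continuous (fun x => Num.max 0 (t x)).
  by move=> x; apply: continuous_max; [exact: cvg_cst|exact: ct].
move=> x; apply: cvgM; first exact: cm.
apply: (@continuous_Rintegral_param X (fun p => f (p.1, Num.max 0 (t p.1) * p.2)));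
  last by lra.
apply: continuous_comp2 => // -[y v]; first exact: cvg_fst.
apply: cvgM; last exact: cvg_snd.
by apply: (@continuous_comp _ _ _ fst (fun x => Num.max 0 (t x)));
  [exact: cvg_fst|exact: cm].
Qed.

Lemma closed_ge0_preimage (X : topologicalType) (p : X -> R) :
  continuous p -> closed [set x | 0 <= p x].
Proof.
move=> cp; apply: (@preimage_closed _ _ p [set y | 0 <= y]) => [x _|]; first exact: cp.
exact: closed_ge.
Qed.

Lemma Rintegral_swap (f : R * R -> R) a b c d : continuous f ->
  \int[mu]_(x in `[a, b]) (\int[mu]_(y in `[c, d]) f (x, y)) =
  \int[mu]_(y in `[c, d]) (\int[mu]_(x in `[a, b]) f (x, y)).
Proof.
move=> cf.
apply: (@Fubini_closed _ f (fst @^-1` `[a, b] `&` snd @^-1` `[c, d]) _ _ _ _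
   (`|a| + `|b| + `|c| + `|d|)) => //.
- apply: closedI; apply: preimage_closed => [p _|]; do ?exact: itv_closed.
    exact: cvg_fst.
  exact: cvg_snd.
- move=> [x y] /= [/=]; rewrite !in_itv/= => /andP[? ?] /andP[? ?].
  have := ler_norm a; have := ler_norm b; have := ler_norm c; have := ler_norm d.
  have := ler_norm (- a); have := ler_norm (- b); have := ler_norm (- c).
  have := ler_norm (- d); rewrite !normrN => *; split; apply/andP; split; lra.
- by move=> x y; split=> -[].
Qed.

Lemma Rintegral_swap_cone (f : R * R -> R) T : continuous f ->
  \int[mu]_(x in `[0, T]) (\int[mu]_(y in `[- x, x]) f (x, y)) =
  \int[mu]_(y in `[- T, T]) (\int[mu]_(x in `[`|y|, T]) f (x, y)).
Proof.
move=> cf.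
apply: (@Fubini_closed _ f ([set p | 0 <= p.1 - `|p.2|] `&` [set p | 0 <= T - p.1])
  _ _ _ _ T) => //.
- apply: closedI; apply: closed_ge0_preimage => p.
    by apply: cvgB; [exact: cvg_fst|apply: cvg_norm; exact: cvg_snd].
  by apply: cvgB; [exact: cvg_cst|exact: cvg_fst].
- move=> [x y] /= [h1 h2]; have := ler_norm y; have := ler_norm (- y).
  have := normr_ge0 y.
  rewrite normrN => *; split; rewrite /= in_itv/=; apply/andP; split; lra.
- move=> x y /=; have := normr_ge0 y; rewrite !in_itv/= -ler_norml => ?.
  split=> [[? ?]|[/andP[? ?] ?]]; last by split; lra.
  by split; [apply/andP; split; lra|lra].
- move=> x y /=; have := normr_ge0 y; rewrite !in_itv/= -ler_norml => ?.
  split=> [[? ?]|[? /andP[? ?]]]; last by split; lra.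
  by split; [lra|apply/andP; split; lra].
Qed.

Lemma Rintegral_swap_triangle (f : R * R -> R) T : continuous f ->
  \int[mu]_(x in `[0, T]) (\int[mu]_(y in `[0, x]) f (x, y)) =
  \int[mu]_(y in `[0, T]) (\int[mu]_(x in `[y, T]) f (x, y)).
Proof.
move=> cf.
apply: (@Fubini_closed _ f ([set p | 0 <= p.2] `&` ([set p | 0 <= p.1 - p.2] `&`
   [set p | 0 <= T - p.1])) _ _ _ _ T) => //.
- apply: closedI; [|apply: closedI]; apply: closed_ge0_preimage => p.
  + exact: cvg_snd.
  + by apply: cvgB; [exact: cvg_fst|exact: cvg_snd].
  + by apply: cvgB; [exact: cvg_cst|exact: cvg_fst].
- move=> [x y] /= [h1 [h2 h3]].
  by split; rewrite /= in_itv/=; apply/andP; split; lra.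
- move=> x y /=; rewrite !in_itv/=.
  split=> [[? [? ?]]|[/andP[? ?] /andP[? ?]]]; last by split; [|split]; lra.
  by split; apply/andP; split; lra.
- move=> x y /=; rewrite !in_itv/=.
  split=> [[? [? ?]]|[/andP[? ?] /andP[? ?]]]; last by split; [|split]; lra.
  by split; apply/andP; split; lra.
Qed.

(** Leibniz' rule in integrated form: [f'] is a density of [f] in the first variable,
    so writing [f (t, u) = f (`|u|, u) + \int_|u|^t f' (_, u)] reduces it to an exchange
    of the order of integration, with no differentiation under the integral. *)
Lemma leibniz_sym (f f' : R * R -> R) r t :
  continuous f -> continuous f' ->
  (forall u s, 0 <= s <= r ->
     f (s, u) = f (0, u) + \int[mu]_(x in `[0, s]) f' (x, u)) ->
  0 <= t <= r ->
  \int[mu]_(u in `[- t, t]) f (t, u) =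
  \int[mu]_(s in `[0, t]) (f (s, s) + f (s, - s) +
     \int[mu]_(u in `[- s, s]) f' (s, u)).
Proof.
move=> cf cf' ff' /andP[t0 tr].
have cid : continuous (fun u : R => u) by move=> u; exact: cvg_id.
have copp : continuous (fun u : R => - u) by move=> u; exact: opp_continuous.
have cabs : continuous (fun u : R => `|u|) by move=> u; exact: cvg_norm.
have step u : `|u| <= t ->
    f (t, u) = f (`|u|, u) + \int[mu]_(x in `[`|u|, t]) f' (x, u).
  move=> ut; rewrite (ff' u t) ?t0// (ff' u `|u|) ?normr_ge0 ?(le_trans ut)//.
  rewrite -addrA; congr (_ + _); apply: Rintegral_split => //.
  by apply: continuous_comp2 => // ?; exact: cvg_cst.
rewrite (@eq_Rintegral _ _ _ mu _ (fun u : R => f (`|u|, u) + \int[mu]_(x in `[`|u|, t]) f' (x, u)));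
  last first.
  move=> u; rewrite inE/= in_itv/= -ler_norml; exact: step.
have c1 : continuous (fun u => f (`|u|, u)) by exact: continuous_comp2.
have c2 : continuous (fun s : R => \int[mu]_(u in `[- s, s]) f' (s, u)).
  exact: continuous_Rintegral_sym.
rewrite RintegralD//=; last 2 first.
- exact: continuous_integrable_itv.
(* The integral with lower end point [|u|] is integrable in [u] because, by [step], it equals a
   difference of two continuous functions. *)
- apply: (@eq_integrable _ _ _ mu `[- t, t] _ (EFin \o (fun u => f (t, u) - f (`|u|, u)))) => //.
    move=> u; rewrite inE/= in_itv/= -ler_norml => /step ->.
    by rewrite addrAC subrr add0r.
  apply: continuous_integrable_itv => u; apply: cvgB; last exact: c1.
  by apply: continuous_comp2 => // ?; exact: cvg_cst.
rewrite -Rintegral_swap_cone// Rintegral_sym// -RintegralD//.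
- apply: eq_Rintegral => s; rewrite inE/= in_itv/= => /andP[s0 _].
  by rewrite normrN ger0_norm.
- apply: continuous_integrable_itv => u; apply: cvgD; first exact: c1.
  by apply: (@continuous_comp _ _ _ (fun u : R => - u) (fun u => f (`|u|, u)));
   [exact: copp|exact: c1].
- exact: continuous_integrable_itv.
Qed.

End Toolkit.

(** * Iterated integrals *)

Section IteratedIntegrals.
Context {R : realType} {n : nat}.
Notation mu := (@lebesgue_measure R).
Notation V := 'rV[R]_n.
Implicit Types (ks : seq 'I_n) (k i j l : 'I_n) (x y : V) (t : R).

Lemma setc_inE x k t l : setc x k t ord0 l = if l == k then t else x ord0 l.
Proof. by rewrite mxE. Qed.

Lemma setcE x k t : setc x k t = x + (t - x ord0 k) *: ebasis R k.
Proof.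
apply/rowP => l; rewrite !mxE eqxx /=; case: eqVneq => [->|_].
  by rewrite mulr1 addrC subrK.
by rewrite mulr0 addr0.
Qed.

Lemma setcC x k j s t : k != j ->
  setc (setc x k s) j t = setc (setc x j t) k s.
Proof.
move=> kj; apply/rowP => l; rewrite !setc_inE.
by case: (eqVneq l j) => // ->; rewrite eq_sym (negbTE kj).
Qed.

Lemma continuous_setc (X : topologicalType) (x : X -> V) k (t : X -> R) :
  continuous x -> continuous t -> continuous (fun p => setc (x p) k (t p)).
Proof.
move=> cx ct; under eq_fun do rewrite setcE.
move=> p; apply: cvgD; first exact: cx.
apply: cvgZ; last exact: cvg_cst.
apply: cvgB; first exact: ct.
by apply: (@continuous_comp _ _ _ x (fun y : V => y ord0 k));
  [exact: cx|exact: coord_continuous].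
Qed.

(** The parameter space is arbitrary, and integrand, half-width and base point all depend on the
    parameter, so that the induction can absorb the outermost integration variable into the
    parameter. *)
Lemma iint_continuous ks (X : topologicalType) (F : X -> V -> R) (t : X -> R)
    (x : X -> V) :
  continuous (fun p : X * V => F p.1 p.2) -> continuous t -> continuous x ->
  continuous (fun p => iint ks (- t p) (t p) (F p) (x p)).
Proof.
elim: ks X F t x => [|k ks IH] X F t x cF ct cx /=.
  by apply: (@continuous_comp2 _ _ _ _ (fun p : X * V => F p.1 p.2)) => // p;
    exact: cvg_id.
apply: (@continuous_Rintegral_sym _ _
  (fun p : X * R => iint ks (- t p.1) (t p.1) (F p.1) (setc (x p.1) k p.2))) => //.
have cfst : continuous (@fst X R) by move=> p; exact: cvg_fst.
have cxf : continuous (fun p : X * R => x p.1).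
  by move=> p; apply: (@continuous_comp _ _ _ fst x); [exact: cfst|exact: cx].
apply: (IH _ (fun p : X * R => F p.1) (fun p : X * R => t p.1)
  (fun p => setc (x p.1) k p.2)).
- apply: (@continuous_comp2 _ _ _ _ (fun p : X * V => F p.1 p.2)) => // -[p y].
    by apply: (@continuous_comp _ _ _ fst fst); exact: cvg_fst.
  exact: cvg_snd.
- by move=> p; apply: (@continuous_comp _ _ _ fst t); [exact: cfst|exact: ct].
- by apply: continuous_setc => // p; exact: cvg_snd.
Qed.

Lemma continuous_snd_fun (X : topologicalType) (F : V -> R) : continuous F ->
  continuous (fun p : X * V => F p.2).
Proof.
move=> cF p; apply: (@continuous_comp _ _ _ snd F); [exact: cvg_snd|exact: cF].
Qed.

Lemma iint_setc_continuous ks (F : V -> R) t x k : continuous F ->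
  continuous (fun u => iint ks (- t) t F (setc x k u)).
Proof.
move=> cF; apply: (@iint_continuous ks R (fun=> F) (fun=> t) (fun u => setc x k u)).
- exact: continuous_snd_fun.
- by move=> u; exact: cvg_cst.
- by apply: continuous_setc => u; [exact: cvg_cst|exact: cvg_id].
Qed.

Lemma eq_iint ks a b (F G : V -> R) x :
  (forall y, (forall l, l \in ks -> a <= y ord0 l <= b) ->
     (forall l, l \notin ks -> y ord0 l = x ord0 l) -> F y = G y) ->
  iint ks a b F x = iint ks a b G x.
Proof.
elim: ks x => [|k ks IH] x FG /=; first by apply: FG.
apply: eq_Rintegral => u; rewrite inE/= in_itv/= => uab.
apply: IH => y yab yx; apply: FG => l.
- rewrite inE; have [lks _|lks] := boolP (l \in ks); first exact: yab.
  by rewrite orbF yx// setc_inE => ->.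
- by rewrite inE negb_or => /andP[lk lks]; rewrite yx// setc_inE (negbTE lk).
Qed.

Lemma eq_iint_base ks a b (F : V -> R) x y :
  (forall l, l \notin ks -> x ord0 l = y ord0 l) ->
  iint ks a b F x = iint ks a b F y.
Proof.
elim: ks x y => [|k ks IH] x y xy /=.
  by congr F; apply/rowP => l; exact: xy.
apply: eq_Rintegral => u _; apply: IH => l lks; rewrite !setc_inE.
by case: eqVneq => // lk; apply: xy; rewrite inE negb_or lk.
Qed.

Lemma iint_setc ks a b (F : V -> R) x k t : k \notin ks ->
  iint ks a b F (setc x k t) = iint ks a b (fun y => F (setc y k t)) x.
Proof.
elim: ks x => //= j ks IH x; rewrite inE negb_or => /andP[kj kks].
by apply: eq_Rintegral => u _; rewrite setcC// IH.
Qed.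

Lemma iint_cat ks ls a b (F : V -> R) x :
  iint (ks ++ ls) a b F x = iint ks a b (iint ls a b F) x.
Proof. by elim: ks x => //= k ks IH x; apply: eq_Rintegral => u _. Qed.

Lemma iintD ks t (F G : V -> R) x : continuous F -> continuous G ->
  iint ks (- t) t (fun y => F y + G y) x =
  iint ks (- t) t F x + iint ks (- t) t G x.
Proof.
move=> cF cG; elim: ks x => //= k ks IH x.
rewrite -RintegralD//; [|exact/continuous_integrable_itv/iint_setc_continuous..].
by apply: eq_Rintegral => u _.
Qed.

Lemma iintZ ks t c (F : V -> R) x : continuous F ->
  iint ks (- t) t (fun y => c * F y) x = c * iint ks (- t) t F x.
Proof.
move=> cF; elim: ks x => //= k ks IH x.
rewrite -RintegralZl//; last exact/continuous_integrable_itv/iint_setc_continuous.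
by apply: eq_Rintegral => u _.
Qed.

Lemma iint0 ks a b x : iint ks a b (fun=> 0) x = 0 :> R.
Proof.
elim: ks x => //= k ks IH x; rewrite (@eq_Rintegral _ _ _ mu _ (cst 0)) => [|u _].
  by rewrite Rintegral_cst// mul0r.
exact: IH.
Qed.

Lemma iint_sum (I : Type) (s : seq I) ks t (F : I -> V -> R) x :
  (forall e, continuous (F e)) ->
  iint ks (- t) t (fun y => \sum_(e <- s) F e y) x =
  \sum_(e <- s) iint ks (- t) t (F e) x.
Proof.
move=> cF; elim: s => [|e s IH].
  by rewrite big_nil; under eq_fun do rewrite big_nil; rewrite iint0.
rewrite big_cons; under eq_fun do rewrite big_cons.
rewrite iintD// ?IH//.
exact: continuous_sum.
Qed.

Lemma Rintegral_sum (I : Type) (s : seq I) a b (f : I -> R -> R) :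
  (forall e, continuous (f e)) ->
  \int[mu]_(u in `[a, b]) (\sum_(e <- s) f e u) =
  \sum_(e <- s) \int[mu]_(u in `[a, b]) f e u.
Proof.
move=> cf; elim: s => [|e s IH].
  rewrite big_nil (@eq_Rintegral _ _ _ mu _ (cst 0)) => [|u _].
    by rewrite Rintegral_cst// mul0r.
  by rewrite big_nil.
rewrite big_cons (@eq_Rintegral _ _ _ mu _
  (fun u => f e u + \sum_(e <- s) f e u)) => [|u _]; last by rewrite big_cons.
rewrite RintegralD// ?IH//; apply: continuous_integrable_itv => //.
exact: continuous_sum.
Qed.

(** [k] passes one variable of [ks] at a time; each transposition is Fubini on a square. *)
Lemma iint_move_front ks ls k t (F : V -> R) x : k \notin ks -> continuous F ->
  iint (ks ++ k :: ls) (- t) t F x = iint (k :: ks ++ ls) (- t) t F x.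
Proof.
move=> + cF; elim: ks x => // j ks IH x; rewrite inE negb_or => /andP[kj kks].
transitivity (iint [:: j, k & ks ++ ls] (- t) t F x).
  by rewrite [LHS]/=; apply: eq_Rintegral => u _; rewrite -/(cat _ _) IH.
rewrite /= (@Rintegral_swap _
  (fun p => iint (ks ++ ls) (- t) t F (setc (setc x j p.1) k p.2)))/=.
  by apply: eq_Rintegral => v _; apply: eq_Rintegral => u _; rewrite setcC// eq_sym.
apply: (@iint_continuous _ _ (fun=> F) (fun=> t)
  (fun p : R * R => setc (setc x j p.1) k p.2)).
- exact: continuous_snd_fun.
- by move=> u; exact: cvg_cst.
- apply: continuous_setc; last by move=> p; exact: cvg_snd.
  by apply: continuous_setc => p; [exact: cvg_cst|exact: cvg_fst].
Qed.

(** The boundary term of Leibniz' rule for a growing box: one pair of opposite faces for each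
    direction of integration. *)
Definition iint_faces ks t (F : V -> R) x : R := \sum_(k <- ks)
  (iint (rem k ks) (- t) t F (setc x k t) + iint (rem k ks) (- t) t F (setc x k (- t))).

Lemma iint_faces_continuous ks (X : topologicalType) (F : X -> V -> R)
    (t : X -> R) (x : X -> V) :
  continuous (fun p : X * V => F p.1 p.2) -> continuous t -> continuous x ->
  continuous (fun p => iint_faces ks (t p) (F p) (x p)).
Proof.
move=> cF ct cx; apply: continuous_sum => k p.
have ctN : continuous (fun p => - t p) by move=> q; apply: cvgN; exact: ct.
apply: cvgD.
  by apply: (@iint_continuous _ _ F t (fun p => setc (x p) k (t p))) => //;
    exact: continuous_setc.
by apply: (@iint_continuous _ _ F t (fun p => setc (x p) k (- t p))) => //;
  exact: continuous_setc.
Qed.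

(** Induction on the directions, with [leibniz_sym] applied to the outermost variable. Its end
    points give the faces in direction [k]; the density [f'] of the inner integral, supplied by the
    induction hypothesis, gives the remaining faces. The initial term is [F 0 x] when [ks] is empty
    and 0 otherwise. *)
Lemma iint_leibniz ks r (F F' : R -> V -> R) : uniq ks ->
  continuous (fun p : R * V => F p.1 p.2) ->
  continuous (fun p : R * V => F' p.1 p.2) ->
  (forall x t, 0 <= t <= r ->
    F t x = F 0 x + \int[mu]_(s in `[0, t]) F' s x) ->
  forall x t, 0 <= t <= r ->
  iint ks (- t) t (F t) x = iint ks 0 0 (F 0) x +
    \int[mu]_(s in `[0, t]) (iint ks (- s) s (F' s) x + iint_faces ks s (F s) x).
Proof.
move=> + cF cF' FF'; elim: ks => [_ x t tr|k ks IH /= /andP[kks uks] x t tr].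
  by rewrite /= FF'//; congr (_ + _); apply: eq_Rintegral => s _;
    rewrite /iint_faces big_nil addr0.
have cfs (X : topologicalType) : continuous (@fst X R) by move=> p; exact: cvg_fst.
have csn (X : topologicalType) : continuous (@snd R X) by move=> p; exact: cvg_snd.
have cst_ (X Y : topologicalType) (z : Y) : continuous (fun _ : X => z).
  by move=> p; exact: cvg_cst.
have cset : continuous (fun p : R * R => setc x k p.2).
  by apply: continuous_setc; [exact: cst_|exact: csn].
have clift (H : R -> V -> R) : continuous (fun p : R * V => H p.1 p.2) ->
    continuous (fun p : (R * R) * V => H p.1.1 p.2).
  move=> cH; apply: (@continuous_comp2 _ _ _ _ (fun p : R * V => H p.1 p.2)) => // -[p y].
    by apply: (@continuous_comp _ _ _ fst fst); exact: cvg_fst.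
  exact: cvg_snd.
have cut (H : R -> V -> R) s : continuous (fun p : R * V => H p.1 p.2) ->
    continuous (H s).
  by move=> cH; apply: (@continuous_comp2 _ _ _ _ (fun p : R * V => H p.1 p.2)) => // p;
   exact: cvg_id.
pose f (p : R * R) := iint ks (- p.1) p.1 (F p.1) (setc x k p.2).
pose f' (p : R * R) := iint ks (- p.1) p.1 (F' p.1) (setc x k p.2) +
   iint_faces ks p.1 (F p.1) (setc x k p.2).
have cIint (H : R -> V -> R) : continuous (fun p : R * V => H p.1 p.2) ->
    continuous (fun p : R * R => iint ks (- p.1) p.1 (H p.1) (setc x k p.2)).
  move=> cH; apply: (@iint_continuous ks _ (fun p : R * R => H p.1) fst
    (fun p => setc x k p.2)) => //;
    [exact: (clift H)|exact: cfs].
have cf : continuous f by exact: cIint.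
have cf' : continuous f'.
  move=> p; apply: cvgD; first exact: (cIint _ cF' p).
  move: p; apply: (@iint_faces_continuous ks _ (fun p : R * R => F p.1) fst
    (fun p => setc x k p.2)) => //;
    [exact: (clift F)|exact: cfs].
rewrite (@leibniz_sym _ f f' r)//; last first.
  by move=> u s sr; rewrite /f /f' /= IH// oppr0.
rewrite set_itv1 Rintegral_set1 add0r; apply: eq_Rintegral => s _.
rewrite /f /f' /= RintegralD//; last 2 first.
- by apply/continuous_integrable_itv/iint_setc_continuous/cut.
- apply: continuous_integrable_itv.
  apply: (@iint_faces_continuous ks _ (fun=> F s) (fun=> s) (fun u => setc x k u)).
  + by apply: continuous_snd_fun; exact: cut.
  + exact: cst_.
  + by apply: continuous_setc; [exact: cst_|move=> p; exact: cvg_id].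
rewrite /iint_faces big_cons/= eqxx addrCA; congr (_ + (_ + _)).
rewrite Rintegral_sum; last first.
  have ccut : continuous (fun p : R * V => F s p.2).
    by apply: continuous_snd_fun; exact: cut.
  have cid : continuous (fun u : R => u) by move=> u; exact: cvg_id.
  move=> j p; apply: cvgD.
    apply: (@iint_continuous _ _ (fun=> F s) (fun=> s) (fun u => setc (setc x k u) j s)).
    - exact: ccut.
    - exact: cst_.
    - apply: continuous_setc; [apply: continuous_setc|]; by [exact: cst_|exact: cid].
  apply: (@iint_continuous _ _ (fun=> F s) (fun=> s) (fun u => setc (setc x k u) j (- s))).
  - exact: ccut.
  - exact: cst_.
  - apply: continuous_setc; [apply: continuous_setc|]; by [exact: cst_|exact: cid].
rewrite big_seq [RHS]big_seq; apply: eq_bigr => j jks.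
have kj : k != j by apply: contraNneq kks => ->.
rewrite (negbTE kj)/= -RintegralD//; last 2 first.
- by apply/continuous_integrable_itv/iint_setc_continuous/cut.
- by apply/continuous_integrable_itv/iint_setc_continuous/cut.
by apply: eq_Rintegral => u _; rewrite !(setcC _ _ _ kj).
Qed.

End IteratedIntegrals.

(** * Faces and edges of the cube *)

Section Core.
Context {R : realType} {n : nat}.
Notation mu := (@lebesgue_measure R).
Notation V := 'rV[R]_n.
Implicit Types (i j k l : 'I_n) (x y : V) (t : R).

Lemma Rintegral_FTC2 (f F : R -> R) (a b : R) : continuous f -> a <= b ->
  (forall u : R, a <= u <= b -> is_derive u (1 : R) F (f u)) ->
  \int[mu]_(u in `[a, b]) f u = F b - F a.
Proof.
move=> cf + dF; rewrite le_eqVlt => /predU1P[<-|ab].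
  by rewrite set_itv1 Rintegral_set1 subrr.
have cF u : a <= u <= b -> {for u, continuous F}.
  move=> /dF dFu; apply: differentiable_continuous; exact/derivable1_diffP.
rewrite /Rintegral (@continuous_FTC2 _ f F)//.
- exact: continuous_subspaceT.
- split.
  + by move=> u /[!in_itv]/= /andP[au ub]; have := dF u; rewrite !ltW//= => -[].
  + by apply/cvg_at_right_filter/cF; rewrite lexx ltW.
  + by apply/cvg_at_left_filter/cF; rewrite lexx ltW.
- move=> u /[!in_itv]/= /andP[au ub]; rewrite derive1E.
  have : a <= u <= b by rewrite !ltW.
  by move/dF => dFu; exact: derive_val.
Qed.

Lemma iint_set0 ks a (F : V -> R) x : ks != [::] -> iint ks a a F x = 0.
Proof. by case: ks => // k ks _ /=; rewrite set_itv1 Rintegral_set1. Qed.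

Lemma rem_enum i : rem i (enum 'I_n) = others i.
Proof. by rewrite rem_filter ?enum_uniq. Qed.

Lemma rem_others i j : rem j (others i) = others2 i j.
Proof.
rewrite rem_filter; last by rewrite filter_uniq ?enum_uniq.
rewrite -filter_predI.
by apply: eq_filter => k /=; rewrite andbC.
Qed.

Lemma others2C i j : others2 i j = others2 j i.
Proof. by apply: eq_filter => k; rewrite andbC. Qed.

Lemma int_P_faces t (F : V -> R) : int_P t F = iint_faces (enum 'I_n) t F 0.
Proof.
rewrite /int_P /iint_faces big_enum/=; apply: eq_bigr => i _.
rewrite !big_cons big_nil addr0 mul1r mulN1r rem_enum; congr (_ + _);
  apply: eq_iint_base => l; rewrite mem_filter mem_enum andbT negbK => /eqP->;
  by rewrite setc_inE eqxx !mxE.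
Qed.

Definition edge t (F : V -> R) i j : R :=
  \sum_(s <- [:: 1; -1]) \sum_(s' <- [:: 1; -1])
    iint (others2 i j) (- t) t F (setc (setc 0 j (s' * t)) i (s * t)).

(** The integrals over the edges of the cube of half-width [t]; below they occur as
    [int_E `|t| F] because this extension to [t < 0] is continuous in [t]. *)
Definition int_E t (F : V -> R) : R := \sum_(i < n) \sum_(j < n | (i < j)%N) edge t F i j.

Lemma continuous_iint_edge i j (s s' : R) (F : V -> R) : continuous F ->
  continuous (fun t => iint (others2 i j) (- `|t|) `|t| F
    (setc (setc 0 j (s' * t)) i (s * t))).
Proof.
move=> cF.
apply: (@iint_continuous _ _ _ R (fun=> F) (fun t => `|t|)
  (fun t => setc (setc 0 j (s' * t)) i (s * t))).
- exact: continuous_snd_fun.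
- by move=> t; exact: cvg_norm.
- apply: continuous_setc; last by move=> t; exact: mulrl_continuous.
  by apply: continuous_setc => t; [exact: cvg_cst|exact: mulrl_continuous].
Qed.

Lemma continuous_edge i j (F : V -> R) : continuous F ->
  continuous (fun t => edge `|t| F i j).
Proof.
move=> cF; apply: continuous_sum => s; apply: continuous_sum => s'.
apply: (@iint_continuous _ _ _ R (fun=> F) (fun t => `|t|)
  (fun t => setc (setc 0 j (s' * `|t|)) i (s * `|t|))).
- exact: continuous_snd_fun.
- by move=> t; exact: cvg_norm.
- have cM (c : R) : continuous (fun t : R => c * `|t|).
    by move=> t; apply: cvgM; [exact: cvg_cst|exact: cvg_norm].
  apply: continuous_setc; last exact: cM.
  by apply: continuous_setc => [t|]; [exact: cvg_cst|exact: cM].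
Qed.

Lemma continuous_int_E (F : V -> R) : continuous F ->
  continuous (fun t => int_E `|t| F).
Proof.
move=> cF; apply: continuous_sum => i.
under eq_fun do rewrite -big_filter.
by apply: continuous_sum => j; exact: continuous_edge.
Qed.

(** Folding [-r, r] onto [0, r] turns the sign [s] and the sign of t into the four sign choices of
    [edge]. As [int_D] takes t itself as a coordinate, no Jacobian factor appears. *)
Lemma int_D_edges r (F : V -> R) : 0 <= r -> continuous F ->
  int_D r F = \int[mu]_(t in `[0, r]) int_E `|t| F.
Proof.
move=> r0 cF; rewrite /int_D /int_E.
rewrite Rintegral_sum; last first.
  move=> i; under eq_fun do rewrite -big_filter.
  by apply: continuous_sum => j; exact: continuous_edge.
apply: eq_bigr => i _; rewrite -big_filter.
rewrite (@eq_Rintegral _ _ _ mu _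
  (fun t => \sum_(j <- [seq j : 'I_n <- index_enum 'I_n | (i < j)%N]) edge `|t| F i j));
  last by move=> t _; rewrite big_filter.
rewrite Rintegral_sum; last by move=> j; exact: continuous_edge.
apply: eq_bigr => j _; rewrite !big_cons big_nil addr0.
have cA (s : R) : continuous (fun t => iint (others2 i j) (- `|t|) `|t| F
    (setc (setc 0 j t) i (s * t))).
  under eq_fun do rewrite -[X in setc _ j X]mul1r.
  exact: continuous_iint_edge.
have cAN (s : R) : continuous (fun t => iint (others2 i j) (- `|- t|) `|- t| F
    (setc (setc 0 j (- t)) i (s * - t))).
  by move=> t; apply: (@continuous_comp _ _ _ (fun t : R => - t)
    (fun t => iint (others2 i j) (- `|t|) `|t| F (setc (setc 0 j t) i (s * t))));
    [exact: opp_continuous|exact: cA].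
rewrite !Rintegral_sym// -RintegralD//; last 2 first.
- by apply: continuous_integrable_itv => t; apply: cvgD; [exact: cA|exact: cAN].
- by apply: continuous_integrable_itv => t; apply: cvgD; [exact: cA|exact: cAN].
apply: eq_Rintegral => t; rewrite inE/= in_itv/= => /andP[t0 _].
rewrite /edge !big_cons !big_nil !addr0 normrN ger0_norm// !mul1r !mulN1r opprK.
lra.
Qed.

(** Leibniz' rule for an integrand that does not depend on t: the density is 0, so only the moving
    faces contribute, and they sweep out the cube. *)
Lemma int_I_cone r (F : V -> R) : (0 < n)%N -> 0 <= r -> continuous F ->
  int_I r F = \int[mu]_(t in `[0, r]) int_P t F.
Proof.
move=> n0 r0 cF; rewrite /int_I.
have c0 : continuous (fun _ : R * V => 0 : R) by move=> p; exact: cvg_cst.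
rewrite (@iint_leibniz _ _ _ r (fun=> F) (fun _ _ => 0))//.
- rewrite iint_set0 ?add0r; last by rewrite -size_eq0 size_enum_ord -lt0n.
  by apply: eq_Rintegral => t _; rewrite iint0 add0r int_P_faces.
- exact: enum_uniq.
- exact: continuous_snd_fun.
- by move=> x t _; rewrite Rintegral_cst// mul0r addr0.
- by rewrite r0 lexx.
Qed.

Lemma iint_facesE i t (F : V -> R) (s : R) :
  iint_faces (others i) t (fun y => F (setc y i (s * t))) 0 =
  \sum_(j < n | j != i) \sum_(s' <- [:: 1; -1])
    iint (others2 i j) (- t) t F (setc (setc 0 j (s' * t)) i (s * t)).
Proof.
rewrite /iint_faces {1}/others big_filter big_enum_cond/=.
apply: eq_bigr => j _; rewrite !big_cons big_nil addr0 mul1r mulN1r rem_others.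
by congr (_ + _); rewrite -iint_setc// mem_filter eqxx.
Qed.

Lemma edgeC t (F : V -> R) i j : i != j -> edge t F i j = edge t F j i.
Proof.
move=> ij; rewrite /edge exchange_big/=; apply: eq_bigr => s _.
by apply: eq_bigr => s' _; rewrite others2C setcC// eq_sym.
Qed.

Lemma sum_edges t (F : V -> R) :
  \sum_(i < n) \sum_(j < n | j != i) edge t F i j = 2 * int_E t F.
Proof.
rewrite mulr_natl mulr2n /int_E.
transitivity (\sum_(i < n) \sum_(j < n | (i < j)%N) edge t F i j +
              \sum_(i < n) \sum_(j < n | (j < i)%N) edge t F i j).
  rewrite -big_split/=; apply: eq_bigr => i _.
  rewrite (bigID (fun j : 'I_n => (i < j)%N))/=; congr (_ + _); apply: eq_bigl => j.
    by rewrite andbC; case: ltngtP => //= ij; rewrite -val_eqE/= gtn_eqF.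
  by rewrite -leqNgt -val_eqE/= ltn_neqAle.
congr (_ + _); rewrite (exchange_big_dep predT)//=.
apply: eq_bigr => j _; apply: eq_bigr => i ji.
by rewrite edgeC// -val_eqE/= gtn_eqF.
Qed.

(** * The weights on surfaces and edges *)

Lemma maxabsE x t i : 0 <= t -> (forall l, `|x ord0 l| <= t) ->
  `|x ord0 i| = t -> maxabs x = t.
Proof.
move=> t0 xt xi; apply/eqP; rewrite eq_le; apply/andP; split.
  by apply: bigmax_le => // l _; exact: xt.
by rewrite -xi; apply: (le_bigmax _ (fun l => `|x ord0 l|)).
Qed.

(** The value of [omega r d] at any point whose max norm is [t]. *)
Definition weight (r : R) (d : nat) t : R := (r - t) ^+ d / d`!%:R.

(** Coordinate [i] stays frozen at absolute value [t] while no other exceeds it, so the max norm is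
    [t] throughout the domain of integration and the weight is a constant factor. *)
Lemma omega_iint r (d : nat) t ks (F : V -> R) x i : 0 <= t ->
  (forall l, l \notin ks -> `|x ord0 l| <= t) -> i \notin ks ->
  `|x ord0 i| = t -> continuous F ->
  iint ks (- t) t (fun y => F y * omega r d y) x = weight r d t * iint ks (- t) t F x.
Proof.
move=> t0 xt iks xi cF; rewrite -iintZ//; apply: eq_iint => y yt yx.
rewrite /omega (@maxabsE y t i)//; first by rewrite mulrC.
- move=> l; have [lks|lks] := boolP (l \in ks); first by rewrite ler_norml yt.
  by rewrite yx// xt.
- by rewrite yx.
Qed.

Lemma int_P_omega r d t (F : V -> R) : 0 <= t -> continuous F ->
  int_P t (fun y => F y * omega r d y) = weight r d t * int_P t F.
Proof.
move=> t0 cF; rewrite /int_P mulr_sumr; apply: eq_bigr => i _.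
have tE (s : R) : s \in [:: 1; -1] -> `|s * t| = t.
  by rewrite !inE normrM => /orP[]/eqP->; rewrite ?normrN normr1 mul1r ger0_norm.
rewrite mulr_sumr big_seq [RHS]big_seq; apply: eq_bigr => s /tE st.
apply: (@omega_iint _ _ _ _ _ _ i) => //.
- by move=> l _; rewrite mxE st.
- by rewrite mem_filter eqxx.
- by rewrite mxE.
Qed.

Lemma int_E_omega r d t (F : V -> R) : 0 <= t -> continuous F ->
  int_E t (fun y => F y * omega r d y) = weight r d t * int_E t F.
Proof.
move=> t0 cF; rewrite /int_E mulr_sumr; apply: eq_bigr => i _.
rewrite mulr_sumr; apply: eq_bigr => j ij.
have tE (s : R) : s \in [:: 1; -1] -> `|s * t| = t.
  by rewrite !inE normrM => /orP[]/eqP->; rewrite ?normrN normr1 mul1r ger0_norm.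
rewrite /edge mulr_sumr big_seq [RHS]big_seq; apply: eq_bigr => s /tE st.
rewrite mulr_sumr big_seq [RHS]big_seq; apply: eq_bigr => s' /tE st'.
apply: (@omega_iint _ _ _ _ _ _ i) => //.
- move=> l; rewrite mem_filter mem_enum andbT negb_and !negbK !setc_inE.
  by case: (l == i) => /=; [rewrite st|move=> ->; rewrite st'].
- by rewrite mem_filter eqxx.
- by rewrite setc_inE eqxx.
Qed.

Lemma continuous_weight r d : continuous (weight r d).
Proof.
move=> t; apply: cvgM; last exact: cvg_cst.
apply: (@continuous_comp _ _ _ (fun t => r - t) (fun u : R => u ^+ d)).
  by apply: cvgB; [exact: cvg_cst|exact: cvg_id].
exact: exprn_continuous.
Qed.

(** This is where the index of the weight rises by one between cube and D_n; the division by the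
    factorial keeps constants out of the passage. *)
Lemma Rintegral_weight r d t : t <= r ->
  \int[mu]_(s in `[t, r]) weight r d s = weight r d.+1 t.
Proof.
move=> tr.
have dF (u : R) : is_derive u (1 : R) (fun s => - weight r d.+1 s) (weight r d u).
  have d0 : d.+1%:R != 0 :> R by rewrite pnatr_eq0.
  have f0 : (d`!)%:R != 0 :> R by rewrite pnatr_eq0 -lt0n fact_gt0.
  have d1 : is_derive u (1 : R) (fun s : R => r - s) (-1).
    by apply: is_derive_eq; rewrite add0r mul1r.
  rewrite [X in is_derive _ _ X _](_ : _ =
      (- (d.+1)`!%:R^-1) \*: ((fun s : R => r - s) ^+ d.+1)); last first.
    apply/funext => s; by rewrite /weight/= fctE/= [RHS]mulNr mulrC.
  apply: is_derive_eq; rewrite /weight /GRing.scale/= factS natrM.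
  by field; rewrite f0 -natr1 addrC in d0 *; rewrite d0.
rewrite (Rintegral_FTC2 (@continuous_weight r d) tr (fun u _ => dF u)).
by rewrite /weight subrr expr0n/= mul0r oppr0 add0r opprK.
Qed.

Lemma continuous_maxabs : continuous (@maxabs R n).
Proof.
suff H s : continuous (fun x : V => \big[Num.max/0]_(l <- s) `|x ord0 l| : R).
  exact: H.
elim: s => [|l s IH].
  rewrite (_ : (fun _ => _) = (fun=> 0)); first exact: cst_continuous.
  by apply/funext => x; rewrite big_nil.
rewrite (_ : (fun _ => _) = (fun x : V => Num.max `|x ord0 l|
    (\big[Num.max/0]_(l <- s) `|x ord0 l|))); last first.
  by apply/funext => x; rewrite big_cons.
move=> x; apply: (@continuous_max _ V (fun x => `|x ord0 l|)
  (fun x : V => \big[Num.max/0]_(l <- s) `|x ord0 l|)); last exact: IH.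
apply: (@continuous_comp _ _ _ (fun x : V => x ord0 l) (fun u : R => `|u|)).
  exact: coord_continuous.
exact: norm_continuous.
Qed.

Lemma continuous_omega r d : continuous (@omega R n r d).
Proof.
move=> x; apply: (@continuous_comp _ _ _ (@maxabs R n) (weight r d)).
  exact: continuous_maxabs.
exact: continuous_weight.
Qed.

End Core.

(** * Harmonic functions *)

Section Harmonic.
Context {R : realType} {n : nat}.
Notation mu := (@lebesgue_measure R).
Notation V := 'rV[R]_n.
Implicit Types (i j k l : 'I_n) (x y : V) (t : R).

(** An integrated form of the statement that [g] is the partial derivative of [G]. It survives
    clamping, for every base point [x], and is the form that Leibniz' rule and the flux computation
    consume. *)
Definition primitive_along (r : R) (G : V -> R) (i : 'I_n) (g : V -> R) : Prop :=
  forall x a b, - r <= a -> a <= b -> b <= r ->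
    \int[mu]_(u in `[a, b]) g (setc x i u) = G (setc x i b) - G (setc x i a).

Lemma iint_others_enum i t (q : V -> R) x : continuous q ->
  iint (others i) (- t) t (iint [:: i] (- t) t q) x = iint (enum 'I_n) (- t) t q x.
Proof.
move=> cq; rewrite -iint_cat iint_move_front ?mem_filter ?eqxx// cats0.
rewrite -rem_enum; have := enum_uniq 'I_n.
have : i \in enum 'I_n by rewrite mem_enum.
case/splitPr => l1 l2; rewrite cat_uniq => /and3P[_ /hasPn/(_ i)].
rewrite mem_head => /(_ isT) il1 _.
rewrite remE index_cat (negbTE il1)/= eqxx addn0 take_size_cat// drop_cat.
by rewrite ltnNge leqnSn/= subSnn/= drop0 iint_move_front.
Qed.

Lemma continuous_setc_base (F : V -> R) i c : continuous F ->
  continuous (fun y => F (setc y i c)).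
Proof.
move=> cF y; apply: (@continuous_comp _ _ _ (fun y : V => setc y i c) F); last exact: cF.
by apply: (@continuous_setc _ _ V id i (fun=> c)) => z;
  [exact: cvg_id|exact: cst_continuous].
Qed.

(** The divergence theorem on a cube: the difference of [g i] over two opposite faces is the
    integral of [q i] over the cube, and the [q i] sum to zero. *)
Lemma flux_eq0 r (g q : 'I_n -> V -> R) t :
  (forall i, continuous (g i)) -> (forall i, continuous (q i)) ->
  (forall i, primitive_along r (g i) i (q i)) ->
  (forall x, \sum_(i < n) q i x = 0) -> 0 <= t <= r ->
  \sum_(i < n) (iint (others i) (- t) t (g i) (setc 0 i t) -
                iint (others i) (- t) t (g i) (setc 0 i (- t))) = 0.
Proof.
move=> cg cq gq q0 /andP[t0 tr].
rewrite (eq_bigr (fun i => iint (enum 'I_n) (- t) t (q i) 0)) => [|i _].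
  rewrite -iint_sum//; under [X in iint _ _ _ X]eq_fun do rewrite q0.
  exact: iint0.
rewrite -(iint_others_enum i)// !iint_setc ?mem_filter ?eqxx// -[- iint _ _ _ _ _]mulN1r -iintZ.
  rewrite -iintD.
  - apply: eq_iint => y _ _ /=; rewrite gq; [by rewrite mulN1r|lra..].
  - exact: continuous_setc_base.
  - exact/continuous_mull/continuous_setc_base.
exact: continuous_setc_base.
Qed.

(** The face x_i = s t moves with velocity [s] along its axis, hence the density [s * g], and it
    grows inside its own hyperplane, hence the term [iint_faces]. *)
Lemma face_leibniz r (H g : V -> R) i s t : (2 <= n)%N ->
  continuous H -> continuous g -> primitive_along r H i g ->
  s \in [:: 1; -1] -> 0 <= t <= r ->
  iint (others i) (- t) t H (setc 0 i (s * t)) =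
  \int[mu]_(x in `[0, t]) (s * iint (others i) (- x) x g (setc 0 i (s * x)) +
    iint_faces (others i) x (fun y => H (setc y i (s * x))) 0).
Proof.
move=> n2 cH cg Hg s1 tr.
have io : i \notin others i by rewrite mem_filter eqxx.
have c2 (F : V -> R) : continuous F ->
    continuous (fun p : R * V => F (setc p.2 i (s * p.1))).
  move=> cF p; apply: (@continuous_comp _ _ _
    (fun p : R * V => setc p.2 i (s * p.1)) F); last exact: cF.
  apply: continuous_setc => q; first exact: cvg_snd.
  by apply: continuous_mull => v; exact: cvg_fst.
have cu (F : V -> R) x : continuous F -> continuous (fun u => F (setc x i u)).
  move=> cF u; apply: (@continuous_comp _ _ _ (fun u : R => setc x i u) F); last exact: cF.
  by apply: continuous_setc => v; [exact: cvg_cst|exact: cvg_id].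
have csu (F : V -> R) x : continuous F -> continuous (fun u => F (setc x i (s * u))).
  move=> cF u; apply: (@continuous_comp _ _ _ (fun u : R => s * u)
    (fun u => F (setc x i u))); last exact: cu.
  exact: mulrl_continuous.
rewrite iint_setc// (@iint_leibniz _ _ _ r (fun t y => H (setc y i (s * t)))
  (fun t y => s * g (setc y i (s * t))))//.
(* The condition [2 <= n] leaves a face at least one direction, so its integral vanishes at t =
   0. *)
- rewrite iint_set0 ?add0r; last first.
    rewrite -size_eq0 -rem_enum size_rem ?mem_enum// size_enum_ord.
    by rewrite -lt0n -subn1 subn_gt0.
  apply: eq_Rintegral => x _; rewrite iintZ ?iint_setc//.
  exact: continuous_setc_base.
- by rewrite filter_uniq ?enum_uniq.
- exact: c2.
- exact/continuous_mull/c2.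
- move=> x u /andP[u0 ur].
  rewrite RintegralZl//; last exact/continuous_integrable_itv/csu.
  move: s1; rewrite !inE => /orP[]/eqP ->.
    under eq_Rintegral do rewrite mul1r.
    by rewrite !mul1r Hg ?subrKC//; lra.
  (* For [s = -1] the integral is reflected to the interval from [- u] to [- 0], where [Hg] applies
     with reversed orientation. *)
  under eq_Rintegral do rewrite mulN1r.
  rewrite -(@Rintegral_opp _ (fun u => g (setc x i u)))//; last exact: cu.
  by rewrite !mulN1r Hg ?opprB ?subrKC//; lra.
Qed.

Lemma int_P_E r (H : V -> R) (g q : 'I_n -> V -> R) t : (2 <= n)%N ->
  continuous H -> (forall i, continuous (g i)) -> (forall i, continuous (q i)) ->
  (forall i, primitive_along r H i (g i)) ->
  (forall i, primitive_along r (g i) i (q i)) ->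
  (forall x, \sum_(i < n) q i x = 0) -> 0 <= t <= r ->
  int_P t H = 2 * \int[mu]_(s in `[0, t]) int_E `|s| H.
Proof.
move=> n2 cH cg cq Hg gq q0 tr.
pose A i (s x : R) : R := s * iint (others i) (- x) x (g i) (setc 0 i (s * x)) +
    iint_faces (others i) x (fun y => H (setc y i (s * x))) 0.
have cid : continuous (fun u : R => u) by move=> u; exact: cvg_id.
have cA i s : continuous (A i s).
  have c1 : continuous (fun x : R => iint (others i) (- x) x (g i) (setc 0 i (s * x))).
    apply: (@iint_continuous _ _ _ R (fun=> g i) (fun x : R => x)
      (fun x : R => setc 0 i (s * x))) => //; first exact: continuous_snd_fun.
    by apply: continuous_setc; [exact: cst_continuous|exact: mulrl_continuous].
  have c2 : continuous (fun x : R => iint_faces (others i) x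
      (fun y => H (setc y i (s * x))) 0).
    apply: (@iint_faces_continuous _ _ _ R (fun (x : R) y => H (setc y i (s * x)))
      (fun x : R => x) (fun=> 0)) => // [p|]; last exact: cst_continuous.
    apply: (@continuous_comp _ _ _ (fun p : R * V => setc p.2 i (s * p.1)) H);
      last exact: cH.
    apply: continuous_setc => z; first exact: cvg_snd.
    by apply: continuous_mull => v; exact: cvg_fst.
  by move=> p; apply: cvgD; [exact: (continuous_mull c1)|exact: c2].
have cE : continuous (fun s : R => int_E `|s| H) by exact: continuous_int_E.
rewrite int_P_faces /iint_faces big_enum/=.
rewrite (eq_bigr (fun i => \int[mu]_(x in `[0, t]) (A i 1 x + A i (-1) x))) => [|i _].
  rewrite -Rintegral_sum => [|i x]; last by apply: cvgD; exact: cA.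
  rewrite -RintegralZl//; last exact: continuous_integrable_itv.
  apply: eq_Rintegral => x; rewrite inE/= in_itv/= => /andP[x0 xt].
  rewrite ger0_norm// -sum_edges.
  have xr : 0 <= x <= r by rewrite x0 (le_trans xt)//; case/andP: tr.
  (* The zero flux is inserted on the right, so that both sides match face pair by face pair: normal
     derivatives on one hand, edges of the two faces on the other. *)
  rewrite -[RHS]add0r -[X in _ = X + _](flux_eq0 cg cq gq q0 xr) -big_split/=.
  apply: eq_bigr => i _; rewrite /A !iint_facesE !mul1r !mulN1r.
  rewrite [in RHS]/edge addrACA; congr (_ + _). rewrite -big_split/=.
  by apply: eq_bigr => j _; rewrite !big_cons !big_nil !addr0 !mul1r !mulN1r.
rewrite RintegralD//; [|exact: continuous_integrable_itv..].
rewrite /A -!(@face_leibniz r)// ?inE ?eqxx ?orbT// rem_enum.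
by rewrite mul1r mulN1r.
Qed.

Lemma int_P_eq_2int_D r (H : V -> R) (g q : 'I_n -> V -> R) : (2 <= n)%N ->
  0 <= r ->
  continuous H -> (forall i, continuous (g i)) -> (forall i, continuous (q i)) ->
  (forall i, primitive_along r H i (g i)) ->
  (forall i, primitive_along r (g i) i (q i)) ->
  (forall x, \sum_(i < n) q i x = 0) ->
  int_P r H = 2 * int_D r H.
Proof.
move=> n2 r0 cH cg cq Hg gq q0.
by rewrite (int_P_E n2 cH cg cq Hg gq q0) ?r0 ?lexx// -int_D_edges.
Qed.

Lemma int_I_eq_2int_D r (d : nat) (H : V -> R) (g q : 'I_n -> V -> R) :
  (2 <= n)%N -> 0 <= r ->
  continuous H -> (forall i, continuous (g i)) -> (forall i, continuous (q i)) ->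
  (forall i, primitive_along r H i (g i)) ->
  (forall i, primitive_along r (g i) i (q i)) ->
  (forall x, \sum_(i < n) q i x = 0) ->
  int_I r (fun x => H x * omega r d x) = 2 * int_D r (fun x => H x * omega r d.+1 x).
Proof.
move=> n2 r0 cH cg cq Hg gq q0.
have cHo e : continuous (fun x => H x * omega r e x).
  by apply: continuous_mulr => //; exact: continuous_omega.
have cE : continuous (fun s : R => int_E `|s| H) by exact: continuous_int_E.
have cw e : continuous (weight r e) by exact: continuous_weight.
rewrite int_I_cone ?(ltnW n2)// int_D_edges//.
(* The surface weight depends on [t] only and is pulled under the integral over [s]. After the
   exchange on the triangle, the variable [t] occurs in the weight alone, which is then integrated
   over [s, r]. *)
rewrite (@eq_Rintegral _ _ _ mu _ (fun t => \int[mu]_(s in `[0, t])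
   (weight r d t * (2 * int_E `|s| H)))) => [|t]; last first.
  rewrite inE/= in_itv/= => tr; have /andP[t0 _] := tr.
  rewrite int_P_omega// (int_P_E n2 cH cg cq Hg gq q0)// -RintegralZl//;
    last exact: continuous_integrable_itv.
  rewrite -RintegralZl//; apply: continuous_integrable_itv => s.
  by apply: cvgM; [exact: cvg_cst|exact: cE].
rewrite (@Rintegral_swap_triangle _ (fun p => weight r d p.1 * (2 * int_E `|p.2| H))); last first.
  move=> p; apply: cvgM.
    by apply: (@continuous_comp _ _ _ fst (weight r d)); [exact: cvg_fst|exact: cw].
  apply: cvgM; first exact: cvg_cst.
  by apply: (@continuous_comp _ _ _ snd (fun s : R => int_E `|s| H)); [exact: cvg_snd|exact: cE].
rewrite -RintegralZl//; last first.
  by apply: continuous_integrable_itv; exact: continuous_int_E.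
apply: eq_Rintegral => s; rewrite inE/= in_itv/= => /andP[s0 sr].
rewrite RintegralZr//; last exact: continuous_integrable_itv.
by rewrite ger0_norm// Rintegral_weight// int_E_omega// mulrCA.
Qed.

End Harmonic.

(** * Continuous extension from the cube by clamping coordinates *)

Section Clamp.
Context {R : realType} {n : nat}.
Notation mu := (@lebesgue_measure R).
Notation V := 'rV[R]_n.
Implicit Types (i j k l : 'I_n) (x y : V) (r t : R).

(** Composition with [clamp r] makes functions that are only controlled on the cube
    continuous everywhere, without changing them on the cube. *)
Definition clamp r x : V := \row_l Num.max (- r) (Num.min r (x ord0 l)).

Lemma clamp_cube r x : 0 <= r -> cube r (clamp r x).
Proof.
move=> r0 l; rewrite mxE ler_norml le_max lexx/= ge_max ge_min lexx andbT/=.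
by rewrite (le_trans _ r0)// oppr_le0.
Qed.

Lemma clamp_id r x : cube r x -> clamp r x = x.
Proof.
move=> rx; apply/rowP => l; rewrite mxE; have := rx l; rewrite ler_norml => /andP[h1 h2].
by rewrite (min_idPr h2) (max_idPr h1).
Qed.

Lemma clamp_setc r x i t : - r <= t <= r ->
  clamp r (setc x i t) = setc (clamp r x) i t.
Proof.
move=> /andP[rt tr]; apply/rowP => l; rewrite !mxE; case: ifPn => // _.
by rewrite (min_idPr tr) (max_idPr rt).
Qed.

Lemma continuous_clamp r : continuous (clamp r).
Proof.
have -> : clamp r = fun x => \sum_(l < n)
    Num.max (- r) (Num.min r (x ord0 l)) *: ebasis R l.
  apply/funext => x; rewrite [LHS]row_sum_delta; apply: eq_bigr => l _.
  by rewrite mxE.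
have cmin l : continuous (fun x : V => Num.min r (x ord0 l)).
  move=> x; apply: (@continuous_min _ V (fun=> r) (fun x => x ord0 l)).
    exact: cst_continuous.
  exact: coord_continuous.
have cmax l : continuous (fun x : V => Num.max (- r) (Num.min r (x ord0 l))).
  move=> x; apply: (@continuous_max _ V (fun=> - r) (fun x => Num.min r (x ord0 l))).
    exact: cst_continuous.
  exact: cmin.
by apply: continuous_sum => l; exact: continuous_scaler.
Qed.

Lemma continuous_comp_clamp r (F : V -> R) : 0 <= r ->
  (forall x, cube r x -> {for x, continuous F}) -> continuous (F \o clamp r).
Proof.
move=> r0 cF x; apply: continuous_comp; first exact: continuous_clamp.
by apply: cF; exact: clamp_cube.
Qed.

Lemma is_derive_setc (F : V -> R) y i (u : R) :
  derivable F (setc y i u) (ebasis R i) ->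
  is_derive u (1 : R) (fun v => F (setc y i v)) ('D_(ebasis R i) F (setc y i u)).
Proof.
move=> dF.
have E : (fun t : R => t^-1 *: (F (setc y i (t *: (1 : R) + u)) - F (setc y i u))) =
    (fun t : R => t^-1 *: (F (t *: ebasis R i + setc y i u) - F (setc y i u))).
  apply/funext => t; congr (_ *: (F _ - _)); apply/rowP => l.
  rewrite !mxE eqxx /GRing.scale/= mulr1.
  by case: eqVneq => _; rewrite ?mulr1 ?mulr0 ?add0r.
by split; [rewrite /derivable E|rewrite /derive E].
Qed.

(** For a value of coordinate [i] in [-r, r], clamping affects only the other coordinates, so the
    segment lies in the cube and the fundamental theorem applies to [F] on it. The function
    differentiated leaves coordinate [i] unclamped and thus has a two-sided derivative at both ends
    as well. *)
Lemma primitive_along_clamp r (F : V -> R) i : 0 <= r ->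
  (forall x, cube r x -> derivable F x (ebasis R i)) ->
  (forall x, cube r x -> {for x, continuous ('D_(ebasis R i) F)}) ->
  primitive_along r (F \o clamp r) i ('D_(ebasis R i) F \o clamp r).
Proof.
move=> r0 dF cF x a b ra ab br.
have rab (u : R) : a <= u <= b -> - r <= u <= r.
  by move=> /andP[au ub]; rewrite (le_trans ra au) (le_trans ub br).
have cf : continuous (fun u : R => ('D_(ebasis R i) F \o clamp r) (setc x i u)).
  move=> u; apply: (@continuous_comp _ _ _ (fun u : R => setc x i u)
    ('D_(ebasis R i) F \o clamp r)); last exact: continuous_comp_clamp.
  by apply: continuous_setc => v; [exact: cvg_cst|exact: cvg_id].
have dG (u : R) : a <= u <= b -> is_derive u (1 : R)
    (fun v => F (setc (clamp r x) i v)) (('D_(ebasis R i) F \o clamp r) (setc x i u)).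
  move=> /rab ur; rewrite /= clamp_setc//; apply: is_derive_setc; apply: dF.
  by rewrite -clamp_setc//; exact: clamp_cube.
by rewrite (Rintegral_FTC2 cf ab dG) /= !clamp_setc// rab// ?lexx ?ab.
Qed.

Lemma primitive_along_cst r (c : R) i :
  primitive_along r (fun=> c) i (fun=> 0).
Proof. by move=> x a b _ _ _; rewrite Rintegral_cst// mul0r subrr. Qed.

Lemma eq_int_P r (F G : V -> R) : 0 <= r -> (forall x, cube r x -> F x = G x) ->
  int_P r F = int_P r G.
Proof.
move=> r0 FG; apply: eq_bigr => i _; rewrite big_seq [RHS]big_seq.
apply: eq_bigr => s s1; apply: eq_iint => y yr yb; apply: FG => l.
have [/yr|/yb ->] := boolP (l \in others i); first by rewrite ler_norml.
by move: s1; rewrite mxE !inE normrM => /orP[]/eqP->;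
  rewrite ?normrN normr1 mul1r ger0_norm.
Qed.

Lemma eq_int_I r (F G : V -> R) : (forall x, cube r x -> F x = G x) ->
  int_I r F = int_I r G.
Proof.
move=> FG; apply: eq_iint => y yr _; apply: FG => l.
by rewrite ler_norml yr// mem_enum.
Qed.

Lemma eq_int_D r (F G : V -> R) : (forall x, cube r x -> F x = G x) ->
  int_D r F = int_D r G.
Proof.
move=> FG; apply: eq_bigr => i _; apply: eq_bigr => j _.
rewrite big_seq [RHS]big_seq; apply: eq_bigr => s s1.
apply: eq_Rintegral => t; rewrite inE/= in_itv/= -ler_norml => tr.
apply: eq_iint => y yr yb; apply: FG => l.
have [/yr|lij] := boolP (l \in others2 i j).
  by rewrite -ler_norml => /le_trans; exact.
rewrite yb//; move: lij s1; rewrite mem_filter mem_enum andbT negb_and !negbK !setc_inE.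
case: (l == i) => [_|/= ->//].
by rewrite !inE normrM => /orP[]/eqP->; rewrite ?normrN normr1 mul1r.
Qed.

End Clamp.

Theorem theorem1 (R : realType) (n : nat) (r : R) (h : 'rV[R]_n -> R) :
  (2 <= n)%N -> 0 < r -> harmonic_near_cube r h ->
  (int_P r h / int_P r (fun _ : 'rV[R]_n => 1) = int_D r h / int_D r (fun _ : 'rV[R]_n => 1)) /\
  (forall k : nat,
     int_I r (fun x => h x * omega r k x) / int_I r (@omega R n r k) =
     int_D r (fun x => h x * omega r k.+1 x) / int_D r (@omega R n r k.+1)).
Proof.
move=> n2 /ltW r0 [U [_ _ cubeU C2h lap0]].
pose H := h \o clamp r.
pose g i := 'D_(ebasis R i) h \o clamp r.
pose q i := 'D_(ebasis R i) ('D_(ebasis R i) h) \o clamp r.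
have cH : continuous H by apply: continuous_comp_clamp => // x /cubeU/C2h[].
have cg i : continuous (g i).
  by apply: continuous_comp_clamp => // x /cubeU/C2h[_ [/(_ i)[]]].
have cq i : continuous (q i).
  by apply: continuous_comp_clamp => // x /cubeU/C2h[_ [_ /(_ i i)[]]].
have Hg i : primitive_along r H i (g i).
  by apply: primitive_along_clamp => // x /cubeU/C2h[_ [/(_ i)[]]].
have gq i : primitive_along r (g i) i (q i).
  by apply: primitive_along_clamp => // x /cubeU/C2h[_ [_ /(_ i i)[]]].
have q0 x : \sum_(i < n) q i x = 0 by exact/lap0/cubeU/clamp_cube.
have hH x : cube r x -> h x = H x by move=> rx; rewrite /H/= clamp_id.
have c_ (c : R) : continuous (fun _ : 'rV[R]_n => c) by exact: cst_continuous.
have sum0 (x : 'rV[R]_n) : \sum_(i < n) (0 : R) = 0 by rewrite big1.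
(* The cancellation rests on 2 being nonzero alone, whatever the value of the denominator [b]. *)
have half (a b : R) : 2 * a / (2 * b) = a / b.
  by rewrite -mulf_div divff ?mul1r// pnatr_eq0.
split=> [|k].
  rewrite (eq_int_P r0 hH) (eq_int_D hH) (int_P_eq_2int_D n2 r0 cH cg cq)//.
  rewrite (@int_P_eq_2int_D _ _ r (fun=> 1) (fun _ _ => 0) (fun _ _ => 0))//.
  - by move=> i; exact: primitive_along_cst.
  - by move=> i; exact: primitive_along_cst.
(* This presents the denominators as weighted integrals of the constant function 1. *)
have omega1 d : @omega R n r d = fun x => 1 * omega r d x.
  by apply/funext => x; rewrite mul1r.
rewrite (@eq_int_I _ _ r _ (fun x => H x * omega r k x)) => [|x /hH->//].
rewrite (@eq_int_D _ _ r _ (fun x => H x * omega r k.+1 x)) => [|x /hH->//].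
rewrite (int_I_eq_2int_D k n2 r0 cH cg cq)// (omega1 k) (omega1 k.+1).
rewrite (@int_I_eq_2int_D _ _ r k (fun=> 1) (fun _ _ => 0) (fun _ _ => 0))//.
- by move=> i; exact: primitive_along_cst.
- by move=> i; exact: primitive_along_cst.
Qed.
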